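(* 1. If $\alpha,\beta\in\mathrm{ord}$ satisfy $I_\alpha=I_\beta$ and $\alpha_i\le\beta_i$ for all $i\in I_\alpha$, then $\alpha\le\beta$. 2. If $\alpha,\beta\in\mathrm{ord}^*$ satisfy $I_\alpha=I_\beta$ and $\alpha_i\le\beta_i$ for all $i\in I_\alpha$, then $\sup(\alpha_i)_{i\in I_\alpha}\le\sup(\beta_i)_{i\in I_\beta}$ (when these sups are defined, i.e. the $\alpha_i,\beta_i$ lie in $\mathrm{ord}^*$); the same holds for sups of finite families in $\mathrm{ord}$. 3. For all $\alpha\in\mathrm{ord}$, $\alpha\le\alpha$; a fortiori $\alpha\le\alpha,\beta^1,\dots,\beta^m$ for any $\beta^1,\dots,\beta^m\in\mathrm{ord}$. 4. For all $\alpha\in\mathrm{ord}^*$ and $i\in I_\alpha$, $\alpha_i<\alpha$; a fortiori $\alpha_i<\alpha,\beta^1,\dots,\beta^m$. 5. For all $\alpha\in\mathrm{ord}$, $\alpha<\alpha$ is impossible. 6. For all $\alpha\in\mathrm{ord}$, $\alpha<\mathrm{succ}(\alpha)$. 7. For $\alpha,\beta\in\mathrm{ord}$: if $\gamma<\beta$ for all $\gamma\in\mathrm{ord}$ with $\gamma<\alpha$, then $\alpha\le\beta$.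
   Context: Work constructively (intuitionistic logic). Let $\mathfrak F$ be a set of index sets such that: $\mathbb N$ and each $\mathbb N_k=\{n\in\mathbb N:n<k\}$ ($k\ge 0$) belong to $\mathfrak F$; every finitely enumerated subset of an element of $\mathfrak F$ is isomorphic to an element of $\mathfrak F$; for $J\in\mathfrak F$ the set of finitely enumerated subsets of $J$ is isomorphic to an element of $\mathfrak F$; $\mathfrak F$ is stable under disjoint unions indexed by elements of $\mathfrak F$. A finitely enumerated subset of $A$ is one given by a map $\mathbb N_k\to A$; write $F\subseteq_f I$. The set $\mathrm{ord}$ of (names of) ordinals is inductively generated by a distinguished element $\underline 0$ and, for every family $(\alpha_i)_{i\in I}$ with $I\in\mathfrak F$ and $\alpha_i\in\mathrm{ord}$, an element $\mathrm S(\alpha_i)_{i\in I}$. Elements of the second kind form $\mathrm{ord}^*$; for $\alpha=\mathrm S(\alpha_i)_{i\in I}$ put $I_\alpha=I$ and call the $\alpha_i$ its definitional subordinals; by convention $I_{\underline 0}=\emptyset$. For a finite list $F$ in $I_\alpha$, $\alpha_F$ is the list of the $\alpha_i$, $i\in F$. $\mathrm{succ}(\alpha)$ denotes $\mathrm S$ of the one-element family $(\alpha)$ indexed by $\{0\}$. Supremum: for a family $(\alpha^j)_{j\in J}$ in $\mathrm{ord}^*$ with $J\in\mathfrak F$, $\sup(\alpha^j)_{j\in J}=\mathrm S(\varepsilon_k)_{k\in K}$ where $K$ is the disjoint union of the $I_{\alpha^j}$ (injections $\iota_j$) and $\varepsilon_{\iota_j(i)}=(\alpha^j)_i$. For a finite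 family in $\mathrm{ord}$, $\sup(\alpha^1,\dots,\alpha^r)$ is $\underline 0$ if all are $\underline 0$, else the sup of those in $\mathrm{ord}^*$. Relations between an element and a nonempty finite list, by simultaneous induction: $\alpha\le\beta^1,\dots,\beta^m$ means $\alpha_i<\beta^1,\dots,\beta^m$ for all $i\in I_\alpha$; $\alpha<\beta^1,\dots,\beta^m$ means there exist $F_1\subseteq_f I_{\beta^1},\dots,F_m\subseteq_f I_{\beta^m}$, not all empty, with $\alpha\le\beta^1_{F_1},\dots,\beta^m_{F_m}$ (concatenated list). *)

(* Defs.v *)
From mathcomp Require Import all_boot.

Set Implicit Arguments.
Unset Strict Implicit.
Unset Printing Implicit Defensive.

Definition iso (A B : Type) : Prop :=
  exists (f : A -> B) (g : B -> A), cancel f g /\ cancel g f.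

Record Frak := {
  inF : Type -> Prop;
  inF_nat : inF nat;
  inF_Nk : forall k : nat, inF 'I_k;
  inF_fin : forall I : Type, inF I -> forall (k : nat) (e : 'I_k -> I),
      exists J : Type, inF J /\ iso J {i : I | exists j, e j = i};
  (* the set of finitely enumerated subsets of J (given by enumerations
     ℕ_k -> J, i.e. finite lists) is isomorphic to an element of 𝔉 *)
  inF_fsubsets : forall J : Type, inF J ->
      exists K : Type, inF K /\ iso K (seq J);
  inF_sigma : forall J : Type, inF J -> forall A : J -> Type,
      (forall j, inF (A j)) -> inF {j : J & A j}
}.

(* Names of ordinals: generated by 0 and S(α_i)_{i ∈ I}, I ∈ 𝔉. *)
Inductive ord (fr : Frak) : Type :=
| Zero : ord fr
| Sup (I : Type) (HI : inF fr I) (f : I -> ord fr) : ord fr.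
Arguments Zero {fr}.
Arguments Sup {fr} I HI f.

Section OrdDefs.
Variable fr : Frak.
Local Notation ord := (ord fr).

Definition is_star (a : ord) : Prop :=
  match a with Zero => False | Sup _ _ _ => True end.
Definition is_starb (a : ord) : bool :=
  match a with Zero => false | Sup _ _ _ => true end.

(* I_α ; by convention I_0 = ∅ (taken to be ℕ_0 = 'I_0) *)
Definition I_ord (a : ord) : Type :=
  match a with Zero => 'I_0 | Sup J _ _ => J end.

Definition I_in_F (a : ord) : inF fr (I_ord a) :=
  match a return inF fr (I_ord a) with
  | Zero => inF_Nk fr 0
  | Sup _ HI _ => HI
  end.

(* definitional subordinals α_i (the Zero case has an empty domain) *)
Definition sub (a : ord) : I_ord a -> ord :=
  match a return I_ord a -> ord with
  | Zero => fun _ => Zero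
  | Sup _ _ f => f
  end.
Arguments sub : clear implicits.

(* A choice of finite lists F_1 ⊆_f I_{β^1}, ..., F_m ⊆_f I_{β^m} *)
Fixpoint sels (L : seq ord) : Type :=
  match L with
  | [::] => unit
  | b :: L' => (seq (I_ord b) * sels L')%type
  end.

Fixpoint picked (L : seq ord) : sels L -> seq ord :=
  match L return sels L -> seq ord with
  | [::] => fun _ => [::]
  | b :: L' => fun s => map (sub b) s.1 ++ @picked L' s.2
  end.
Arguments picked : clear implicits.

Fixpoint all_empty (L : seq ord) : sels L -> bool :=
  match L return sels L -> bool with
  | [::] => fun _ => true
  | b :: L' => fun s => nilp s.1 && @all_empty L' s.2
  end.
Arguments all_empty : clear implicits.

(* α ≤ β^1,...,β^m : for all i ∈ I_α, α_i < β^1,...,β^m, where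
   γ < β^1..β^m : there are F_j ⊆_f I_{β^j}, not all empty, with
   γ ≤ β^1_{F_1},...,β^m_{F_m}.  (Simultaneous induction on α.) *)
Fixpoint ord_le (a : ord) (L : seq ord) {struct a} : Prop :=
  match a with
  | Zero => True
  | Sup _ _ f => forall i,
      exists s : sels L, ~~ all_empty L s /\ ord_le (f i) (picked L s)
  end.

Definition ord_lt (a : ord) (L : seq ord) : Prop :=
  exists s : sels L, ~~ all_empty L s /\ ord_le a (picked L s).

Definition succ (a : ord) : ord := Sup 'I_1 (inF_Nk fr 1) (fun _ => a).

(* sup of a family (α^j)_{j ∈ J} (intended for α^j ∈ ord^* ):
   S(ε_k)_{k ∈ K}, K = disjoint union of the I_{α^j}. *)
Definition sup (J : Type) (HJ : inF fr J) (a : J -> ord) : ord :=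
  Sup {j : J & I_ord (a j)}
      (inF_sigma HJ (fun j => I_in_F (a j)))
      (fun k => sub (a (projT1 k)) (projT2 k)).

Definition fsup (l : seq ord) : ord :=
  let l' := filter is_starb l in
  if nilp l' then Zero
  else sup (inF_Nk fr (size l')) (fun j : 'I_(size l') => nth Zero l' j).

Definition cast_idx (A B : Type) (e : A = B) (i : A) : B :=
  eq_rect A (fun T => T) i B e.

End OrdDefs.
Arguments sub {fr} a i.
Arguments picked {fr} L s.
Arguments all_empty {fr} L s.

(* Main.v *)
Require Import Defs.
From Stdlib Require Import List.
From mathcomp Require Import all_boot.

Set Implicit Arguments.
Unset Strict Implicit.
Unset Printing Implicit Defensive.

(* Both x <= L and x < L only depend on the set of children of elements of L;
   this gives the monotonicity statements.  For irreflexivity, suppose every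
   element of a nonempty list L satisfies x < L.  Merging the witnesses gives
   a nonempty list L' of children of elements of L such that x <= L' for all
   x in L, hence y < L' for every y in L'.  Passing from L to such an L' is a
   well-founded relation on finite lists (the lifting of the well-founded
   subterm relation), so this descent cannot go on forever. *)

Lemma incl_nilp (T : Type) (C P : seq T) : incl C P -> nilp P -> nilp C.
Proof. by case: P => // /incl_l_nil ->. Qed.

Lemma In_nthP (T : Type) (x0 x : T) (l : seq T) :
  In x l <-> exists2 p, p < size l & nth x0 l p = x.
Proof.
elim: l => [|y l IH] /=; first by split=> // -[].
split=> [[<-|/IH [p hp <-]]|[[|p] /= hp hpx]]; first by exists 0.
- by exists p.+1.
- by left.
- by right; apply/IH; exists p.
Qed.

Section SeqDescent.
Variables (T : Type) (r : T -> T -> Prop).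

Definition below (Z L : seq T) : Prop :=
  forall y, In y Z -> exists2 x, In x L & r y x.

Definition descent (Z L : seq T) : Prop := ~~ nilp Z /\ below Z L.

Lemma below_incl (Z L L' : seq T) : incl L L' -> below Z L -> below Z L'.
Proof. by move=> hLL' hZ y /hZ [x /hLL' hx hyx]; exists x. Qed.

Lemma below_cat (Z1 Z2 L : seq T) :
  below Z1 L -> below Z2 L -> below (Z1 ++ Z2) L.
Proof. by move=> h1 h2 y /in_app_iff [/h1|/h2]. Qed.

Lemma below_split (Z L1 L2 : seq T) : below Z (L1 ++ L2) ->
  exists Z1 Z2, [/\ below Z1 L1, below Z2 L2 & incl Z (Z1 ++ Z2)].
Proof.
elim: Z => [|y Z IH] hZ; first by exists [::], [::]; split=> ? [].
have [|Z1 [Z2 [h1 h2 hZ12]]] := IH; first by move=> z hz; apply: hZ; right.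
have [x /in_app_iff [hx|hx] hyx] := hZ y (or_introl erefl).
- exists (y :: Z1), Z2; split=> // [z [<-|/h1] //|]; first by exists x.
  by move=> z [<-|/hZ12]; [left|right].
- exists Z1, (y :: Z2); split=> // [z [<-|/h2] //|]; first by exists x.
  by move=> z [<-|/hZ12]; rewrite !in_app_iff /=; tauto.
Qed.

Lemma acc_descent_nil : Acc descent [::].
Proof.
apply: Acc_intro => -[|y Z] [nZ hZ]; first by [].
by have [] := hZ y (or_introl erefl).
Qed.

Lemma acc_descent_below (Z L : seq T) :
  Acc descent L -> below Z L -> Acc descent Z.
Proof.
case: Z => [|y Z] accL hZ; first exact: acc_descent_nil.
by apply: (Acc_inv accL); split.
Qed.

Lemma acc_descent_incl (Z L : seq T) :
  Acc descent L -> incl Z L -> Acc descent Z.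
Proof.
move=> accL hZL; apply: Acc_intro => Z' [nZ' hZ'].
by apply: (Acc_inv accL); split=> //; apply: below_incl hZ'.
Qed.

(* Only [L1] needs an induction: a descent of [L1 ++ L2] splits into a part
   below [L1], a descent of [L1] unless empty, and a part below [L2], which is
   accessible outright. *)
Lemma acc_descent_cat (L1 L2 : seq T) :
  Acc descent L1 -> Acc descent L2 -> Acc descent (L1 ++ L2).
Proof.
move=> acc1; elim: acc1 L2 => {}L1 _ IH L2 acc2.
apply: Acc_intro => Z [_ /below_split [Z1 [Z2 [h1 h2 hZ12]]]].
apply: acc_descent_incl hZ12.
case: Z1 h1 => [|z Z1] h1; first exact: acc_descent_below acc2 h2.
by apply: IH; [split | exact: acc_descent_below acc2 h2].
Qed.

Lemma acc_descent_all (Z : seq T) :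
  (forall y, In y Z -> Acc descent [:: y]) -> Acc descent Z.
Proof.
elim: Z => [|y Z IH] hZ; first exact: acc_descent_nil.
apply: (@acc_descent_cat [:: y]); first by apply: hZ; left.
by apply: IH => z hz; apply: hZ; right.
Qed.

Lemma acc_descent_single (x : T) : Acc r x -> Acc descent [:: x].
Proof.
elim=> {}x _ IH; apply: Acc_intro => Z [_ hZ].
by apply: acc_descent_all => y /hZ [x' [<-|[]]]; apply: IH.
Qed.

Lemma wf_descent : well_founded r -> well_founded descent.
Proof.
by move=> wfr L; apply: acc_descent_all => y _; apply: acc_descent_single.
Qed.

End SeqDescent.

Section OrdLe.
Variable fr : Frak.
Local Notation ord := (ord fr).

Definition child (y x : ord) : Prop := exists k, y = sub x k.

Definition children_incl (x y : ord) : Prop :=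
  forall k : I_ord x, child (sub x k) y.

Lemma wf_child : well_founded child.
Proof.
move=> a; elim: a => [|I HI f IH]; apply: Acc_intro => _ [k ->].
  by case: k.
exact: IH.
Qed.

Fixpoint no_sel (L : seq ord) : sels L :=
  match L with [::] => tt | b :: L' => ([::], no_sel L') end.

Lemma all_emptyE (L : seq ord) (s : sels L) :
  all_empty L s = nilp (picked L s).
Proof.
by elim: L s => //= b L IH [s1 s2]; rewrite IH cat_nilp /nilp size_map.
Qed.

Lemma picked_below (L : seq ord) (s : sels L) : below child (picked L s) L.
Proof.
elim: L s => [|b L IH] /= s y; first by case.
case/in_app_iff=> [/in_map_iff [k [<- _]]|/IH [x hx hyx]].
  by exists b; [left | exists k].
by exists x; [right|].
Qed.

Lemma sel_add (L : seq ord) (s : sels L) b (k : I_ord b) : In b L ->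
  exists t, incl (picked L s) (picked L t) /\ In (sub b k) (picked L t).
Proof.
elim: L s => [|c L IH] //= [s1 s2] [ecb|hb].
  by subst c; exists (k :: s1, s2); split=> [y|] /=; [right | left].
have [t [hst hk]] := IH s2 hb.
exists (s1, t); split=> [y|] /=; rewrite !in_app_iff; last by right.
by case=> [|/hst]; [left|right].
Qed.

Lemma sel_cover (L C : seq ord) : below child C L ->
  exists t : sels L, incl C (picked L t).
Proof.
elim: C => [|y C IH] hC; first by exists (no_sel L).
have [t ht] := IH (fun z hz => hC z (or_intror hz)).
have [b hb [k ->]] := hC y (or_introl erefl).
have [t' [htt' hk]] := sel_add t k hb.
by exists t' => z [<-|/ht /htt'].
Qed.

Lemma ord_le_sub (a : ord) (L : seq ord) :
  ord_le a L <-> forall i : I_ord a, ord_lt (sub a i) L.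
Proof. by case: a => //=; split=> // _ []. Qed.

Lemma lt_of_le_child (b : ord) (k : I_ord b) (x : ord) :
  ord_le x [:: sub b k] -> ord_lt x [:: b].
Proof. by exists ([:: k], tt). Qed.

Lemma le_refl (a : ord) : ord_le a [:: a].
Proof.
elim: a => [|I HI f IH] //= i.
exact: (@lt_of_le_child (Sup I HI f) i) (IH i).
Qed.

Lemma lt_sub (a : ord) (i : I_ord a) : ord_lt (sub a i) [:: a].
Proof. exact: lt_of_le_child (le_refl _). Qed.

Lemma le_subset (x : ord) (L L' : seq ord) :
  incl L L' -> ord_le x L -> ord_le x L'.
Proof.
elim: x L L' => [|I HI f IH] L L' hLL' //= hx i.
have [s [ns hs]] := hx i.
have [t ht] := sel_cover (below_incl hLL' (picked_below (s := s))).
exists t; split; last exact: IH hs.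
by rewrite all_emptyE in ns; rewrite all_emptyE (contra (incl_nilp ht)).
Qed.

Lemma lt_belowP (x : ord) (L : seq ord) :
  ord_lt x L <-> exists C, [/\ ~~ nilp C, below child C L & ord_le x C].
Proof.
split=> [[s [ns hs]]|[C [nC hC hx]]].
  by exists (picked L s); rewrite -all_emptyE; split=> //; apply: picked_below.
have [t ht] := sel_cover hC.
exists t; rewrite all_emptyE; split; first exact: contra (incl_nilp ht) nC.
exact: le_subset ht hx.
Qed.

Lemma lt_children_mono (x : ord) (L L' : seq ord) :
  (forall y b, In b L -> child y b -> exists2 b', In b' L' & child y b') ->
  ord_lt x L -> ord_lt x L'.
Proof.
move=> hLL' /lt_belowP [C [nC hC hx]]; apply/lt_belowP; exists C.
by split=> // y /hC [b hb]; apply: hLL'.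
Qed.

Lemma le_cover (a b : ord) :
  (forall k : I_ord a, exists a' b',
     [/\ child (sub a k) a', ord_le a' [:: b'] & children_incl b' b]) ->
  ord_le a [:: b].
Proof.
move=> h; apply/ord_le_sub => k.
have [a' [b' [[k' ->] /ord_le_sub hle hb']]] := h k.
apply: lt_children_mono (hle k') => y _ [<-|[]] [m ->].
by exists b; [left | apply: hb'].
Qed.

Lemma children_incl_sup (J : Type) (HJ : inF fr J) (a : J -> ord) (j : J) :
  children_incl (a j) (sup HJ a).
Proof. by move=> k; exists (existT _ j k). Qed.

Lemma le_sup (J J' : Type) (HJ : inF fr J) (HJ' : inF fr J')
    (a : J -> ord) (b : J' -> ord) (g : J -> J') :
  (forall j, ord_le (a j) [:: b (g j)]) -> ord_le (sup HJ a) [:: sup HJ' b].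
Proof.
move=> h; apply: le_cover => -[j k].
exists (a j), (b (g j)); split=> //; first by exists k.
exact: children_incl_sup.
Qed.

Lemma fsup_child (y : ord) (l : seq ord) :
  child y (fsup l) -> exists2 x, In x l & child y x.
Proof.
rewrite /fsup; set l' := filter _ l; case: ifP => _ [k ->]; first by case: k.
case: k => j k; exists (nth Zero l' j); last by exists k.
have /filter_In [] // : In (nth Zero l' j) l' by apply/(In_nthP Zero); exists j.
Qed.

Lemma fsup_children_incl (x : ord) (l : seq ord) :
  In x l -> children_incl x (fsup l).
Proof.
case: x => [|I HI f] hx k; first by case: k.
rewrite /fsup; set l' := filter _ l.
have /(In_nthP Zero) [q hq hqx] : In (Sup I HI f) l' by apply/filter_In.
have nl' : ~~ nilp l' by rewrite /nilp -lt0n (leq_ltn_trans _ hq).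
move: k; rewrite -hqx (negbTE nl') => k.
by exists (existT _ (Ordinal hq) k).
Qed.

Lemma le_fsup (l1 l2 : seq ord) : size l1 = size l2 ->
  (forall i, i < size l1 -> ord_le (nth Zero l1 i) [:: nth Zero l2 i]) ->
  ord_le (fsup l1) [:: fsup l2].
Proof.
move=> hsz h; apply: le_cover => k.
have [|x hx [m ->]] := @fsup_child (sub (fsup l1) k) l1; first by exists k.
have [p hp hpx] := (In_nthP Zero _ _).1 hx.
exists x, (nth Zero l2 p); split; first by exists m.
  by rewrite -hpx; apply: h.
by apply: fsup_children_incl; apply/(In_nthP Zero); exists p; rewrite -?hsz.
Qed.

Lemma lt_all_merge (L M : seq ord) : (forall x, In x L -> ord_lt x M) ->
  exists C, [/\ ~~ nilp L -> ~~ nilp C, below child C M &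
                forall x, In x L -> ord_le x C].
Proof.
elim: L => [|x L IH] hL; first by exists [::]; split=> // ? [].
have [C [_ hC hLC]] := IH (fun y hy => hL y (or_intror hy)).
have /lt_belowP [Cx [nCx hCx hx]] := hL x (or_introl erefl).
exists (Cx ++ C); split; first by rewrite cat_nilp negb_and nCx.
  exact: below_cat.
move=> y [<-|/hLC hy].
  by apply: le_subset hx => z hz; apply/in_app_iff; left.
by apply: le_subset hy => z hz; apply/in_app_iff; right.
Qed.

Lemma not_all_lt_self (L : seq ord) :
  ~~ nilp L -> ~ (forall x, In x L -> ord_lt x L).
Proof.
elim: (wf_descent wf_child L) => {}L _ IH nL hL.
have [C [nC hC hLC]] := lt_all_merge hL.
apply: (IH C); [by split; [apply: nC|] | exact: nC |].
by move=> y /hC [b /hLC /ord_le_sub hb [k ->]].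
Qed.

End OrdLe.

Theorem lemma3p16 (fr : Frak) :
  (* 1 *)
  (forall (a b : ord fr) (e : I_ord a = I_ord b),
      (forall i : I_ord a, ord_le (sub a i) [:: sub b (cast_idx e i)]) ->
      ord_le a [:: b]) /\
  (* 2, families indexed by an element of 𝔉 *)
  (forall (a b : ord fr) (e : I_ord a = I_ord b),
      is_star a -> is_star b ->
      (forall i : I_ord a, is_star (sub a i)) ->
      (forall i : I_ord b, is_star (sub b i)) ->
      (forall i : I_ord a, ord_le (sub a i) [:: sub b (cast_idx e i)]) ->
      ord_le (sup (I_in_F a) (sub a)) [:: sup (I_in_F b) (sub b)]) /\
  (* 2, finite families in ord *)
  (forall l1 l2 : seq (ord fr), size l1 = size l2 ->
      (forall i, i < size l1 -> ord_le (nth Zero l1 i) [:: nth Zero l2 i]) ->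
      ord_le (fsup l1) [:: fsup l2]) /\
  (* 3 *)
  (forall a : ord fr, ord_le a [:: a] /\
      forall bs : seq (ord fr), ord_le a (a :: bs)) /\
  (* 4 *)
  (forall (a : ord fr) (i : I_ord a), is_star a ->
      ord_lt (sub a i) [:: a] /\
      forall bs : seq (ord fr), ord_lt (sub a i) (a :: bs)) /\
  (* 5 *)
  (forall a : ord fr, ~ ord_lt a [:: a]) /\
  (* 6 *)
  (forall a : ord fr, ord_lt a [:: succ a]) /\
  (* 7 *)
  (forall a b : ord fr,
      (forall g : ord fr, ord_lt g [:: a] -> ord_lt g [:: b]) ->
      ord_le a [:: b]).
Proof.
split.
  by move=> a b e h; apply/ord_le_sub => i; apply: lt_of_le_child (h i).
split.
  by move=> a b e _ _ _ _; apply: le_sup.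
split; first exact: le_fsup.
split.
  move=> a; split=> [|bs]; first exact: le_refl.
  by apply: le_subset (le_refl a) => y [<-|[]]; left.
split.
  move=> a i _; split=> [|bs]; first exact: lt_sub.
  by apply: lt_children_mono (lt_sub i) => y b [<-|[]] hy; exists a; [left|].
split.
  by move=> a ha; apply: (@not_all_lt_self _ [:: a]) => // x [<-|[]].
split.
  by move=> a; apply: (@lt_of_le_child _ (succ a) ord0); apply: le_refl.
by move=> a b h; apply/ord_le_sub => i; apply: h; apply: lt_sub.
Qed.
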